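(* Let $\mathsf{M}\in\mathbb{C}^{D\times D}$ be a non-nilpotent matrix, let $\{\mathsf{M}_{\mu\nu}\}_{1\le\mu,\nu\le n}$ be an arbitrary partition of $\mathsf{M}$, and let $q\in\mathbb{C}$. Let $\mathcal{G}$ be the graph of the partition $\{(\mathsf{M}-\mathsf{I})_{\mu\nu}\}$ of $\mathsf{M}-\mathsf{I}$ (same projectors), and let $\mathcal{G}_0$ be $\mathcal{G}$ with all self-loops deleted. Then for all $\alpha,\omega$ the partition of $\mathsf{M}^q$ is given by $$(\mathsf{M}^{q})_{\omega\alpha}=-\mathcal{Z}^{-1}\left\{\sum_{P_{\mathcal{G}_0;\alpha\omega}}\mathsf{F}_{\mathcal{G}\backslash\{\alpha,\nu_2,\ldots,\nu_\ell\}}[\omega]\,\mathsf{M}_{\omega\nu_\ell}\cdots \mathsf{F}_{\mathcal{G}\backslash\{\alpha\}}[\nu_2]\,\mathsf{M}_{\nu_2\alpha}\,\mathsf{F}_\mathcal{G}[\alpha]\right\}[n]\Bigg|_{n=-q-1},$$ where the sum runs over all paths $(\alpha,\nu_2,\ldots,\nu_\ell,\omega)$ from $\alpha$ to $\omega$ on $\mathcal{G}_0$, $\ell$ is the length of the path, and $\mathsf{F}$ is defined recursively (for $\mathcal{G}$ and, in the same way, for each graph obtained from it by deleting vertices) by $$\mathsf{F}_{\mathcal{G}}[\alpha] = \left[\mathsf{I}z^{-1} -\mathsf{M}_\alpha-\sum_{C_{\mathcal{G}_0;\alpha}}\mathsf{M}_{\alpha\mu_m}\, \mathsf{F}_{\mathcal{G}\backslash\{\alpha,\mu_2,\ldots,\mu_{m-1}\}}[\mu_m]\cdots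 \mathsf{F}_{\mathcal{G}\backslash\{\alpha\}}[\mu_2]\,\mathsf{M}_{\mu_2\alpha}\right]^{-1},$$ where the sum runs over all bare cycles $(\alpha,\mu_2,\ldots,\mu_m,\alpha)$ off $\alpha$ on $\mathcal{G}_0$ and $m$ is the length of the bare cycle.
   Context: Partition of a matrix: let $V=V_1\oplus\cdots\oplus V_n=\mathbb{C}^D$, where each $V_\mu$ (of dimension $d_\mu\geq 1$) is spanned by a subset of the standard orthonormal basis vectors, these subsets being disjoint. Let $\mathsf{R}_\mu\in\mathbb{C}^{d_\mu\times D}$ be the restriction to these coordinates, so $\mathsf{R}_\mu^{\mathrm T}\mathsf{R}_\mu=\varepsilon_\mu$ is the orthogonal projector onto $V_\mu$. The corresponding partition of a $D\times D$ matrix $\mathsf{A}$ is the family $\mathsf{A}_{\mu\nu}=\mathsf{R}_\mu\mathsf{A}\mathsf{R}_\nu^{\mathrm T}$ (of size $d_\mu\times d_\nu$), $1\le\mu,\nu\le n$; equivalently, up to a permutation of the coordinates, a block decomposition of $\mathsf{A}$. One writes $\mathsf{A}_\mu=\mathsf{A}_{\mu\mu}$. The partition of a matrix function $f(\mathsf{M})$ is taken with the same projectors. $\mathsf{I}$ is the identity matrix of the appropriate size. Graph of a partition $\{\mathsf{A}_{\mu\nu}\}$: the directed graph with vertices labelled $1,\ldots,n$ and with a directed edge from $\nu$ to $\mu$, written $(\nu\mu)$, whenever $\mathsf{A}_{\mu\nu}\neq 0$ (self-loops included). $\mathcal{G}\backslash\{\alpha,\beta,\ldots\}$ is $\mathcal{G}$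 with the vertices $\alpha,\beta,\ldots$ deleted; a subscript $0$ means that all self-loops are deleted. Path: a walk whose vertices are all distinct; its length is its number of edges. $P_{\mathcal{G};\alpha\omega}$ is the set of paths from $\alpha$ to $\omega$; if $\omega=\alpha$ it consists only of the length-zero path, which contributes $\mathsf{F}_{\mathcal{G}}[\alpha]$. Bare cycle off $\alpha$: a closed walk of positive length from $\alpha$ to $\alpha$ that does not revisit any internal vertex and visits $\alpha$ only at its ends; $C_{\mathcal{G};\alpha}$ is the set of these. An empty sum is zero, so if $\alpha$ has no neighbours in the graph, $\mathsf{F}[\alpha]=[\mathsf{I}z^{-1}-\mathsf{M}_\alpha]^{-1}$. $z$ is the Z-domain variable, and the quantities $\mathsf{F}$ are matrices of rational functions of $z$. $\mathcal{Z}^{-1}\{g(z)\}[n]$ is the inverse unilateral Z-transform, i.e. the coefficient of $z^{-n}$, $n\ge0$, in the expansion of $g$ at $z=\infty$. For the functions at hand it is a linear combination of terms (polynomial in $n$) $\times\,\lambda^{-n-1}$ with $\lambda$ nonzero eigenvalues of $\mathsf{M}$; this closed form is used to evaluate it at $n=-q-1\in\mathbb{C}$, so that $\lambda^{-n-1}$ becomes $\lambda^{q}$. Meaning of $\mathsf{M}^q$: for $\|\mathsf{M}-\mathsf{I}\|<1$ it is $\sum_{k\ge0}\binom{q}{k}(\mathsf{M}-\mathsf{I})^k$, extended beyond this domain by analytic continuation. Explicitly, $\mathsf{M}^q=\sum_{\lambda\ne0}\sum_{j\ge0}\binom{q}{j}\lambda^{q-j}(\mathsf{M}-\lambda\mathsf{I})^j\,\Pi_\lambda$,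 the sum being over the nonzero eigenvalues $\lambda$ of $\mathsf{M}$, with $\Pi_\lambda$ the spectral projector onto the generalized eigenspace of $\lambda$ (so that for singular $\mathsf{M}$, $q=-1$ gives the Drazin inverse). For each $\lambda$ one fixed branch of $\lambda^q$ is used on both sides (the principal branch when $\|\mathsf{M}-\mathsf{I}\|<1$). *)

(* Defs.v *)
From HB Require Import structures.
From mathcomp Require Import all_boot all_order all_algebra.
From mathcomp Require Import complex.
From mathcomp Require Import reals sequences exp trigo.

Set Implicit Arguments.
Unset Strict Implicit.
Unset Printing Implicit Defensive.

Import Order.TTheory GRing.Theory Num.Theory.
Local Open Scope ring_scope.

Section Partition.
Variables (D n : nat) (B : 'I_n -> {set 'I_D}).

(* V_mu is spanned by the standard basis vectors e_i with i in B mu; the B mu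
   are nonempty, pairwise disjoint, and cover all the coordinates. *)
Definition is_partition : Prop :=
  [/\ forall mu, B mu != set0,
      forall mu nu, mu != nu -> [disjoint B mu & B nu]
    & \bigcup_mu B mu = [set: 'I_D]].

Definition bdim (mu : 'I_n) : nat := #|B mu|.

(* The rows of 1%:M whose index is in B mu, in increasing order. *)
Definition restr (S : nzRingType) (mu : 'I_n) : 'M[S]_(bdim mu, D) :=
  rowsub (fun k : 'I_(bdim mu) => enum_val k) 1%:M.

Definition block (S : nzRingType) (A : 'M[S]_D) (mu nu : 'I_n) :
    'M[S]_(bdim mu, bdim nu) :=
  restr S mu *m A *m (restr S nu)^T.

Definition graph (S : nzRingType) (A : 'M[S]_D) : rel 'I_n :=
  fun nu mu => block A mu nu != 0.

End Partition.

Definition delete (T : finType) (X : {set T}) (e : rel T) : rel T :=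
  fun x y => [&& x \notin X, y \notin X & e x y].

Definition loopless (T : eqType) (e : rel T) : rel T :=
  fun x y => (x != y) && e x y.

Section PathSum.
Variables (C : fieldType) (D n : nat) (B : 'I_n -> {set 'I_D}) (M : 'M[C]_D).

Local Notation K := {fraction {poly C}}.
Local Notation d := (bdim B).

Definition zvar : K := tofrac 'X.

Definition ratC (a : C) : K := tofrac a%:P.

Local Notation Mz mu nu := (map_mx ratC (block B M mu nu)).

(* The graph G \ X with its self-loops deleted. *)
Definition G0 (X : {set 'I_n}) : rel 'I_n :=
  loopless (delete X (graph B (M - 1%:M))).

(* For F X beta standing for F_{G\X}[beta], and p = [:: nu_2; ...; nu_k], this
   is the product over the vertex sequence (beta, nu_2, ..., nu_k):
   F_{G\(X,beta,nu_2,...,nu_{k-1})}[nu_k] M_{nu_k nu_{k-1}} ...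
   F_{G\(X,beta)}[nu_2] M_{nu_2 beta} F_{G\X}[beta]. *)
Fixpoint path_weight (F : {set 'I_n} -> forall mu, 'M[K]_(d mu))
    (X : {set 'I_n}) (beta : 'I_n) (p : seq 'I_n) :
    'M[K]_(d (last beta p), d beta) :=
  match p with
  | [::] => F X beta
  | nu :: p' => path_weight F (beta |: X) nu p' *m Mz nu beta *m F X beta
  end.

(* The bare cycle (alpha, mu_2, ..., mu_m, alpha) is encoded by its internal
   vertices c = [:: mu_2; ...; mu_m]; since there are no self-loops, c = [::]
   is never a bare cycle and its weight is irrelevant. *)
Definition cycle_weight (F : {set 'I_n} -> forall mu, 'M[K]_(d mu))
    (X : {set 'I_n}) (alpha : 'I_n) (c : seq 'I_n) : 'M[K]_(d alpha) :=
  match c with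
  | [::] => 0
  | mu2 :: c' => Mz alpha (last mu2 c')
                 *m path_weight F (alpha |: X) mu2 c' *m Mz mu2 alpha
  end.

(* A bare cycle has at most n - 1 internal vertices, so that bounding the
   length k by n loses nothing. *)
Definition cycle_sum (F : {set 'I_n} -> forall mu, 'M[K]_(d mu))
    (X : {set 'I_n}) (alpha : 'I_n) : 'M[K]_(d alpha) :=
  \sum_(k < n) \sum_(c : k.-tuple 'I_n | ucycleb (G0 X) (alpha :: c))
    cycle_weight F X alpha c.

(* Every matrix inverted here (for alpha \notin X) is invertible over C(z). *)
Definition Fstep (F : {set 'I_n} -> forall mu, 'M[K]_(d mu))
    (X : {set 'I_n}) (alpha : 'I_n) : 'M[K]_(d alpha) :=
  invmx (zvar^-1%:M - Mz alpha alpha - cycle_sum F X alpha).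

Fixpoint Frec (fuel : nat) (X : {set 'I_n}) (alpha : 'I_n) : 'M[K]_(d alpha) :=
  if fuel is k.+1 then Fstep (Frec k) X alpha else 0.

(* F_{G\X}[alpha] for alpha \notin X; the fuel is the number of vertices of
   G\X, which suffices: F satisfies the recursion F_eq. *)
Definition F (X : {set 'I_n}) (alpha : 'I_n) : 'M[K]_(d alpha) :=
  Frec #|~: X| X alpha.

Lemma path_weight_ext (F1 F2 : {set 'I_n} -> forall mu, 'M[K]_(d mu))
    (X : {set 'I_n}) (beta : 'I_n) (p : seq 'I_n) :
    {in beta :: p, forall x, x \notin X} -> uniq (beta :: p) ->
    (forall (Y : {set 'I_n}) mu,
       X \subset Y -> mu \notin Y -> F1 Y mu = F2 Y mu) ->
  path_weight F1 X beta p = path_weight F2 X beta p.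
Proof.
elim: p X beta => [|nu p IHp] X beta pX /= u_p eqF.
  by apply: eqF => //; apply: pX; rewrite inE.
have Xbeta : beta \notin X by apply: pX; rewrite mem_head.
case/andP: u_p => bp u_p; rewrite (eqF X) // (IHp (beta |: X)) //.
- move=> x xp; rewrite !inE negb_or; apply/andP; split.
    by apply: contraNneq bp => <-.
  by apply: pX; rewrite inE xp orbT.
- by move=> Y mu sXY; apply: eqF; apply: subset_trans sXY; apply: subsetUr.
Qed.

Lemma cycle_sum_ext (F1 F2 : {set 'I_n} -> forall mu, 'M[K]_(d mu))
    (X : {set 'I_n}) (alpha : 'I_n) :
    (forall (Y : {set 'I_n}) mu,
       alpha |: X \subset Y -> mu \notin Y -> F1 Y mu = F2 Y mu) ->
  cycle_sum F1 X alpha = cycle_sum F2 X alpha.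
Proof.
move=> eqF; apply: eq_bigr => k _; apply: eq_bigr => -[c /= _].
case: c => [//|mu c] /andP[/= /andP[_ e_c] /andP[alc u_c]].
rewrite (path_weight_ext (F2 := F2)) // => x xc.
rewrite !inE negb_or; apply/andP; split; first by apply: contraNneq alc => <-.
have: {in mu :: c, forall y, y \notin X} => [|->//].
elim: c mu e_c {alc u_c xc} => [|nu c IHc] mu /=.
  by rewrite andbT => /and4P[_ muX _ _] y; rewrite inE => /eqP ->.
case/andP=> /and4P[_ muX _ _] /IHc cX y; rewrite inE => /predU1P[-> //|].
exact: cX.
Qed.

Lemma Fstep_ext (F1 F2 : {set 'I_n} -> forall mu, 'M[K]_(d mu))
    (X : {set 'I_n}) (alpha : 'I_n) :
    (forall (Y : {set 'I_n}) mu,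
       alpha |: X \subset Y -> mu \notin Y -> F1 Y mu = F2 Y mu) ->
  Fstep F1 X alpha = Fstep F2 X alpha.
Proof. by move=> eqF; rewrite /Fstep (cycle_sum_ext eqF). Qed.

Lemma Frec_fuel (k k' : nat) (X : {set 'I_n}) (alpha : 'I_n) :
    alpha \notin X -> (#|~: X| <= k)%N -> (#|~: X| <= k')%N ->
  Frec k X alpha = Frec k' X alpha.
Proof.
have ltC (Y : {set 'I_n}) (mu : 'I_n) :
    mu \notin Y -> (#|~: (mu |: Y)| < #|~: Y|)%N.
  move=> Ymu; apply/proper_card/properP; split.
    by rewrite setCS subsetUr.
  by exists mu; rewrite !inE ?eqxx.
have gt0 (Y : {set 'I_n}) (mu : 'I_n) : mu \notin Y -> (#|~: Y| <= 0)%N = false.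
  by move=> /ltC; case: #|~: Y|.
elim: k k' X alpha => [|k IHk] k' X alpha Xal; first by rewrite (gt0 X alpha).
case: k' => [|k'] lek; first by rewrite (gt0 X alpha).
move=> lek'; apply: Fstep_ext => Y mu sXY Ymu.
have leY : (#|~: Y| < #|~: X|)%N.
  by apply: leq_ltn_trans (ltC X alpha Xal); rewrite subset_leq_card ?setCS.
by apply: IHk Ymu _ _; rewrite -ltnS; apply: leq_trans leY _.
Qed.

Lemma F_eq (X : {set 'I_n}) (alpha : 'I_n) :
  alpha \notin X -> F X alpha = Fstep F X alpha.
Proof.
move=> Xal; apply: etrans (Frec_fuel Xal (leqnn _) (leqnSn _)) _.
apply: Fstep_ext => Y mu sXY Ymu; apply: (Frec_fuel Ymu) (leqnn _).
by rewrite subset_leq_card // setCS; apply: subset_trans sXY; apply: subsetUr.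
Qed.

Definition is_path (alpha omega : 'I_n) (p : seq 'I_n) : bool :=
  [&& path (G0 set0) alpha p, uniq (alpha :: p) & last alpha p == omega].

(* p lists the vertices of the path after alpha; its length is at most n - 1.
   conform_mx only casts along last alpha p = omega. *)
Definition path_sum (omega alpha : 'I_n) : 'M[K]_(d omega, d alpha) :=
  \sum_(l < n) \sum_(p : l.-tuple 'I_n | is_path alpha omega p)
    conform_mx 0 (path_weight F set0 alpha p).

End PathSum.

Section MatrixPower.
Variable R : realType.
Local Notation C := R[i].

Definition cexp (w : C) : C :=
  (expR (complex.Re w) * cos (complex.Im w)
   +i* (expR (complex.Re w) * sin (complex.Im w)))%C.

(* An arbitrary choice, for each nonzero lambda, of a logarithm of lambda. *)
Definition is_log (L : C -> C) : Prop :=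
  forall lambda, lambda != 0 -> cexp (L lambda) = lambda.

(* The branch of lambda ^ q (lambda != 0) determined by L. *)
Definition cpow (L : C -> C) (lambda q : C) : C := cexp (q * L lambda).

Definition gbinom (q : C) (j : nat) : C :=
  (\prod_(i < j) (q - i%:R)) / j`!%:R.

(* The distinct eigenvalues of M. *)
Definition spectrum (D : nat) (M : 'M[C]_D) : seq C :=
  undup (sval (closed_field_poly_normal (char_poly M))).

Lemma mem_spectrum (D : nat) (M : 'M[C]_D) (a : C) :
  (a \in spectrum M) = eigenvalue M a.
Proof.
rewrite /spectrum mem_undup; case: closed_field_poly_normal => r /= chE.
rewrite eigenvalue_root_char {}[X in root X]chE rootZ ?root_prod_XsubC //.
by rewrite lead_coef_eq0 monic_neq0 // char_poly_monic.
Qed.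

(* The spectral projector of M for the eigenvalue lambda, acting on column
   vectors (geigenspace and proj_mx work with row vectors, hence the
   transpositions): projection onto the generalized eigenspace for lambda along
   the sum of the other generalized eigenspaces. *)
Definition spectral_proj (D : nat) (M : 'M[C]_D) (lambda : C) : 'M[C]_D :=
  (proj_mx (geigenspace M^T lambda)
     (\sum_(mu <- spectrum M | mu != lambda) geigenspace M^T mu)%MS)^T.

(* The terms with j >= D vanish. *)
Definition mxpow (L : C -> C) (D : nat) (M : 'M[C]_D) (q : C) : 'M[C]_D :=
  \sum_(lambda <- spectrum M | lambda != 0) \sum_(j < D)
    (gbinom q j * cpow L lambda (q - j%:R))
      *: ((M - lambda%:M) ^+ j *m spectral_proj M lambda).

End MatrixPower.

Section InverseZ.
Variable R : realType.
Local Notation C := R[i].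

(* The Laurent series \sum_k (c k) z^k, with finitely many positive powers of
   z, is the expansion of g at z = oo: writing g = p / q, it satisfies
   q * \sum_k (c k) z^k = p. *)
Definition expansion_at_oo (g : {fraction {poly C}}) (c : int -> C) : Prop :=
  (exists N : int, forall k : int, N < k -> c k = 0) /\
  exists p q : {poly C},
    [/\ q != 0, g = tofrac p / tofrac q
      & forall m : int, \sum_(i < size q) q`_i * c (m - i%:Z)
                        = if m is Posz j then p`_j else 0].

(* v is the value at the complex argument s of the closed form
     n |-> \sum_lambda P_lambda(n) lambda^(- n - 1)
   of the coefficient of z^-n in g, n = 0, 1, ..., lambda ranging over the
   distinct nonzero elements of Lambda.  The polynomials P_lambda, for these
   lambda, are determined by g, hence so is v. *)
Definition inverse_Z_at (L : C -> C) (Lambda : seq C)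
    (g : {fraction {poly C}}) (s v : C) : Prop :=
  exists (c : int -> C) (P : C -> {poly C}),
    [/\ expansion_at_oo g c,
        forall n : nat, c (- n%:Z) =
          \sum_(lambda <- undup Lambda | lambda != 0)
            (P lambda).[n%:R] * lambda ^- n.+1
      & v = \sum_(lambda <- undup Lambda | lambda != 0)
              (P lambda).[s] * cpow L lambda (- s - 1)].

End InverseZ.

(* Main.v *)
Require Import Defs.
From mathcomp Require Import all_boot all_order all_algebra.
From mathcomp Require Import complex reals.
From HB Require Import structures.
From mathcomp Require Import sequences exp trigo ring.
Import Order.TTheory GRing.Theory Num.Theory.
Local Open Scope ring_scope.

Set Implicit Arguments.
Unset Strict Implicit.
Unset Printing Implicit Defensive.

(* Let T_X be the inverse of the principal submatrix of 1/z - M on the vertices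
   outside X. Schur complementation with respect to one vertex a gives
     T_X[a,a] = (1/z - M_aa - M_a T_{X+a} M_a)^-1 and
     T_X[w,a] = T_{X+a}[w,.] M_.a T_X[a,a] for w <> a;
   unfolding these equations recursively yields the sums over bare cycles and
   over paths, so that the path sum is the (w,a) block of (1/z - M)^-1. The
   matrices inverted on the way are invertible since det(1 - zM) is 1 at z = 0.
   At z = oo the nilpotent part of M only produces positive powers of z in the
   expansion of (1/z - M)^-1, whereas the coefficient of z^-n, n >= 0, is
   -M^(-n-1) on the generalized eigenspaces of nonzero eigenvalues; by the
   binomial formula it is a polynomial in n times a^(-n-1) for each eigenvalue
   a, and its value at n = -q-1 is -M^q. *)

(** * Path sums and the resolvent *)

Section Schur.
Variables (K : fieldType) (D : nat).
Implicit Types E A T M : 'M[K]_D.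

(* For a coordinate projector [E], this says that [T] is the inverse of the
   principal submatrix [E A E], extended by zero; working with [T] avoids
   submatrices of varying sizes. *)
Definition is_compressed_inv E A T :=
  [/\ E *m T = T, T *m E = T, E *m A *m T = E & T *m A *m E = E].

(** The matrix [Q] acts as [w] off the image of [E] and as the compression of [w - M] on it. It
    commutes with [E], so cutting [invmx Q] down by [E] inverts that compression. *)
Lemma compressed_invP E M (w : K) : E *m E = E ->
    w%:M - E *m M *m E \in unitmx ->
  is_compressed_inv E (w%:M - M)
    (E *m invmx (w%:M - E *m M *m E) *m E).
Proof.
move=> EE; set Q := w%:M - E *m M *m E => Qu.
have EQ : E *m Q = Q *m E.
  by rewrite /Q mulmxBr mulmxBl !mulmxA EE -[E *m M *m E *m E]mulmxA EE
    scalar_mxC.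
have EAE : E *m (w%:M - M) *m E = Q *m E.
  by rewrite /Q mulmxBr !mulmxBl -!mulmxA EE -scalar_mxC (mulmxA E E) EE.
split.
- by rewrite !mulmxA EE.
- by rewrite -!mulmxA EE.
- by rewrite !mulmxA EAE -EQ mulmxK // EE.
- rewrite -!mulmxA (mulmxA E (_ - _)) EAE mulKmx //.
Qed.

(** Block elimination, with [r] selecting the eliminated coordinates and [E] the others. The
    [E]-rows of the inverse relation express [E T r^T] through [G]; substitution into the [r]-rows
    leaves the Schur complement times [G]. The scalar [w] drops out of the off-diagonal blocks. *)
Lemma schur_complement (k : nat) (r : 'M[K]_(k, D)) (w : K) E M T T' :
    r *m r^T = 1%:M -> r *m E = 0 -> E *m r^T = 0 -> E *m E = E ->
    is_compressed_inv E (w%:M - M) T' ->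
    is_compressed_inv (r^T *m r + E) (w%:M - M) T ->
  let G := r *m T *m r^T in
  T *m r^T = r^T *m G + T' *m M *m r^T *m G /\
  (w%:M - r *m M *m r^T - r *m M *m T' *m M *m r^T) *m G = 1%:M.
Proof.
move=> rr rE Er EE [ET' T'E _ T'AE] [ET TE EAT _] G.
have T'r : T' *m r^T = 0 by rewrite -T'E -mulmxA Er mulmx0.
have rT' : r *m T' = 0 by rewrite -ET' mulmxA rE mul0mx.
set A := w%:M - M in T'AE EAT *.
(* Since [T' A E = E], the matrix [T' A] fixes [E T r^T]; moreover [T' A T r^T = 0], as the [E]-rows
   of [A T] are orthogonal to [r]. *)
have ETr : E *m T *m r^T = T' *m M *m r^T *m G.
  have <- : T' *m A *m (E *m T *m r^T) = E *m T *m r^T by rewrite !mulmxA T'AE.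
  have -> : E *m T *m r^T = T *m r^T - r^T *m G.
    by rewrite -[in RHS]ET !mulmxDl !mulmxA addrAC subrr add0r.
  have EeE : E *m (r^T *m r + E) = E.
    by rewrite mulmxDr mulmxA Er mul0mx add0r EE.
  have EAT' : E *m A *m T = E.
    by rewrite -{1}EeE -[E *m _ *m A]mulmxA -[E *m _ *m T]mulmxA EAT EeE.
  have T'AT : T' *m A *m T *m r^T = 0.
    by rewrite -T'E -!mulmxA (mulmxA E) [E *m A *m _]mulmxA EAT' Er mulmx0.
  have T'Ar : T' *m A *m r^T = - (T' *m M *m r^T).
    by rewrite mulmxBr mulmxBl scalar_mxC -[w%:M *m T' *m r^T]mulmxA T'r
      mulmx0 sub0r.
  by rewrite mulmxBr mulmxA T'AT sub0r [_ *m (r^T *m G)]mulmxA T'Ar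
    mulNmx opprK.
have Tr : T *m r^T = r^T *m G + T' *m M *m r^T *m G.
  by rewrite -{1}ET !mulmxDl ETr !mulmxA.
split=> //.
have <- : r *m A *m (T *m r^T) = 1%:M.
  have reE : r *m (r^T *m r + E) = r.
    by rewrite mulmxDr mulmxA rr mul1mx rE addr0.
  by rewrite mulmxA -{1}reE -[r *m _ *m A]mulmxA -[r *m _ *m T]mulmxA EAT reE.
rewrite Tr mulmxDr !mulmxA -mulmxDl; congr (_ *m _).
rewrite mulmxBr !mulmxBl scalar_mxC -[w%:M *m r *m r^T]mulmxA rr mulmx1.
by rewrite -[w%:M *m r *m T']mulmxA rT' mulmx0 !mul0mx sub0r.
Qed.

End Schur.

Lemma big_tuple_cons (V : nmodType) (T : finType) (k : nat)
    (Q : pred (seq T)) (f : seq T -> V) :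
  \sum_(p : k.+1.-tuple T | Q p) f p
  = \sum_x \sum_(p : k.-tuple T | Q (x :: p)) f (x :: p).
Proof.
rewrite pair_big_dep /=.
rewrite (reindex (fun u : T * k.-tuple T => [tuple of u.1 :: u.2])) //=.
exists (fun p => (thead p, [tuple of behead p])) => [[x p] _|p _] /=.
  by congr (_, _); apply: val_inj.
by rewrite [RHS]tuple_eta; apply: val_inj.
Qed.

HB.instance Definition _ (C : fieldType) :=
  GRing.RMorphism.copy (@ratC C) (@tofrac {poly C} \o @polyC C).

(** * Coordinate restrictions and projectors of a partition *)

Section Restr.
Variables (D n : nat) (B : 'I_n -> {set 'I_D}).
Hypothesis hB : is_partition B.

Lemma map_restr (S S' : nzRingType) (f : {rmorphism S -> S'}) mu :
  map_mx f (restr B S mu) = restr B S' mu.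
Proof. by apply/matrixP=> i j; rewrite !mxE rmorph_nat. Qed.

Variable S : nzRingType.
Local Notation r := (restr B S).

Lemma restr_mulE m (A : 'M[S]_(D, m)) mu : r mu *m A = rowsub enum_val A.
Proof. by rewrite mul_rowsub_mx mul1mx. Qed.

Lemma blockE (A : 'M[S]_D) mu nu i j :
  block B A mu nu i j = A (enum_val i) (enum_val j).
Proof.
by rewrite /block trmx_mxsub trmx1 mulmx_colsub mulmx1 restr_mulE !mxE.
Qed.

Lemma restrK mu : r mu *m (r mu)^T = 1%:M.
Proof.
by apply/matrixP=> i j; rewrite restr_mulE !mxE (inj_eq enum_val_inj) eq_sym.
Qed.

Lemma restr_orth mu nu : mu != nu -> r mu *m (r nu)^T = 0.
Proof.
case: hB => _ dis _ /dis /pred0P dis_mn; apply/matrixP=> i j.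
rewrite restr_mulE !mxE; case: eqP => // eij.
by have:= dis_mn (enum_val i); rewrite /= enum_valP -eij enum_valP.
Qed.

(** Here [X] is the set of deleted vertices, so the image is spanned by the coordinates of the
    remaining graph. *)
Definition coordproj (X : {set 'I_n}) : 'M[S]_D :=
  \sum_(mu | mu \notin X) (r mu)^T *m r mu.

Lemma restr_proj mu (X : {set 'I_n}) : mu \notin X ->
  r mu *m coordproj X = r mu.
Proof.
move=> Xmu; rewrite mulmx_sumr (bigD1 mu) //= mulmxA restrK mul1mx.
rewrite big1 ?addr0 // => nu /andP[_ nemn].
by rewrite mulmxA restr_orth ?mul0mx // eq_sym.
Qed.

Lemma restr_proj0 mu (X : {set 'I_n}) : mu \in X -> r mu *m coordproj X = 0.
Proof.
move=> Xmu; rewrite mulmx_sumr big1 // => nu Xnu.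
by rewrite mulmxA restr_orth ?mul0mx //; apply: contraNneq Xnu => <-.
Qed.

Lemma proj_restr0 mu (X : {set 'I_n}) : mu \in X -> coordproj X *m (r mu)^T = 0.
Proof.
move=> Xmu; rewrite mulmx_suml big1 // => nu Xnu.
by rewrite -mulmxA restr_orth ?mulmx0 //; apply: contraNneq Xnu => ->.
Qed.

Lemma proj_idem X : coordproj X *m coordproj X = coordproj X.
Proof.
rewrite {1}/coordproj mulmx_suml; apply: eq_bigr => mu Xmu.
by rewrite -mulmxA restr_proj.
Qed.

Lemma proj_setU1 mu (X : {set 'I_n}) : mu \notin X ->
  coordproj X = (r mu)^T *m r mu + coordproj (mu |: X).
Proof.
move=> Xmu; rewrite /coordproj (bigD1 mu) //=; congr (_ + _).
by apply: eq_bigl => nu; rewrite !inE negb_or andbC.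
Qed.

Lemma proj_set0 : coordproj set0 = 1%:M.
Proof.
case: hB => _ dis cov; apply/matrixP=> i j; rewrite summxE mxE.
have /bigcupP[mu _ imu] : i \in \bigcup_mu B mu by rewrite cov inE.
rewrite (bigD1 mu) ?inE //= big1 => [|nu /andP[_ nemu]]; last first.
  have iNnu : i \notin B nu by rewrite (disjointFl (dis _ _ nemu) imu).
  rewrite !mxE big1 // => k _; rewrite !mxE.
  case: eqP => [ki|]; last by rewrite mul0r.
  by rewrite -ki enum_valP in iNnu.
rewrite addr0 !mxE (bigD1 (enum_rank_in imu i)) //= big1 => [|k nek].
  by rewrite !mxE enum_rankK_in // eqxx mul1r addr0.
rewrite !mxE; case: eqP => [ki|]; last by rewrite mul0r.
by case/eqP: nek; apply: enum_val_inj; rewrite enum_rankK_in.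
Qed.
End Restr.

(** * Weights of paths and bare cycles as blocks of resolvents *)

Section PathSums.
Variables (C : fieldType) (D n : nat) (B : 'I_n -> {set 'I_D}) (M : 'M[C]_D).
Hypothesis hB : is_partition B.
Local Notation K := {fraction {poly C}}.
Local Notation w := (zvar C)^-1.
Local Notation MK := (map_mx (@ratC C) M).
Local Notation r := (restr B K).
Local Notation E := (coordproj B K).
Local Notation FM := (F B M).
Local Notation pw := (path_weight M FM).
Implicit Types (X : {set 'I_n}) (alpha beta mu nu : 'I_n) (p c : seq 'I_n).

Lemma zvar_neq0 : zvar C != 0.
Proof. by rewrite tofrac_eq0 polyX_eq0. Qed.

Lemma det_1subXM_neq0 (N : 'M[C]_D) :
  \det (1%:M - 'X *: map_mx polyC N) != 0.
Proof.
apply/eqP => /(congr1 (horner_eval 0)).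
rewrite -det_map_mx /= {2}/horner_eval horner0.
rewrite rmorphB /= map_mx1 map_mxZ /= {1}/horner_eval hornerX scale0r subr0.
by rewrite det1 => /eqP; rewrite oner_eq0.
Qed.

Lemma resolvent_poly (N : 'M[C]_D) :
  w%:M - map_mx (@ratC C) N
  = w *: map_mx (@tofrac {poly C}) (1%:M - 'X *: map_mx polyC N).
Proof.
rewrite map_mxB map_mx1 map_mxZ /= scalerBr scalemx1 scalerA mulVf ?scale1r.
  by rewrite -map_mx_comp.
exact: zvar_neq0.
Qed.

Lemma resolvent_unit (N : 'M[C]_D) : w%:M - map_mx (@ratC C) N \in unitmx.
Proof.
rewrite resolvent_poly unitmxZ ?unitfE ?invr_eq0 ?zvar_neq0 //.
by rewrite unitmxE det_map_mx unitfE tofrac_eq0 det_1subXM_neq0.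
Qed.

(** This is [T_X] extended by zero. The matrix under [invmx] is [1/z] on the deleted coordinates,
    which keeps it invertible. *)
Definition resolvent X : 'M[K]_D :=
  E X *m invmx (w%:M - E X *m MK *m E X) *m E X.
Local Notation T := resolvent.

Lemma resolventP X : is_compressed_inv (E X) (w%:M - MK) (T X).
Proof.
apply: compressed_invP; first exact: proj_idem.
(* The projector has constant entries, so the compression of [M] is again a matrix over [C] and
   [resolvent_unit] applies. *)
have <- : map_mx (@ratC C) (coordproj B C X) = E X.
  rewrite /coordproj map_mx_sum; apply: eq_bigr => mu _.
  by rewrite map_mxM -map_trmx map_restr.
by rewrite -!map_mxM resolvent_unit.
Qed.

Lemma resolvent_set0 : T set0 = invmx (w%:M - MK).
Proof. by rewrite /T (proj_set0 hB) !mul1mx !mulmx1. Qed.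

Lemma resolvent_schur X alpha : alpha \notin X ->
  let G := r alpha *m T X *m (r alpha)^T in
  T X *m (r alpha)^T = (r alpha)^T *m G
    + T (alpha |: X) *m MK *m (r alpha)^T *m G /\
  (w%:M - r alpha *m MK *m (r alpha)^T
    - r alpha *m MK *m T (alpha |: X) *m MK *m (r alpha)^T) *m G = 1%:M.
Proof.
move=> Xa; apply: (@schur_complement _ _ _ _ _ (E (alpha |: X))).
- exact: restrK.
- by rewrite (restr_proj0 hB) ?setU11.
- by rewrite (proj_restr0 hB) ?setU11.
- exact: proj_idem.
- exact: resolventP.
- by rewrite -proj_setU1 //; apply: resolventP.
Qed.

Lemma map_block mu nu :
  map_mx (@ratC C) (block B M mu nu) = r mu *m MK *m (r nu)^T.
Proof. by rewrite /block !map_mxM -map_trmx !map_restr. Qed.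

(** The graph is that of [M - 1], but off-diagonal blocks of the identity vanish, so a missing edge
    between distinct vertices is a zero block of [M] itself. *)
Lemma non_edge X mu nu : mu != nu -> mu \notin X -> nu \notin X ->
  ~~ G0 B M X mu nu -> r nu *m MK *m (r mu)^T = 0.
Proof.
move=> nemn Xmu Xnu; rewrite /G0 /loopless /delete /graph nemn Xmu Xnu /=.
rewrite negbK /block mulmxBr mulmxBl mulmx1 restr_orth ?subr0 //;
  last by rewrite eq_sym.
by move=> /eqP M0; rewrite -map_block /block M0 map_mx0.
Qed.

(* The weight of a path extended by zero to a D x D matrix, so that its type
   does not depend on the end points. *)
Definition wt X beta p : 'M[K]_D :=
  (r (last beta p))^T *m pw X beta p *m r beta.

Lemma wt_nil X beta : wt X beta [::] = (r beta)^T *m FM X beta *m r beta.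
Proof. by []. Qed.

Lemma wt_cons X beta nu p :
  wt X beta (nu :: p) = wt (beta |: X) nu p *m MK *m wt X beta [::].
Proof. by rewrite /wt /= map_block !mulmxA. Qed.

Lemma path_notin X alpha p : path (G0 B M X) alpha p -> all [predC X] p.
Proof. by elim: p alpha => //= nu p IH alpha /andP[/and4P[_ _ -> _] /IH]. Qed.

Lemma sub_path_G0 X (Y : {set 'I_n}) alpha p : X \subset Y ->
  path (G0 B M Y) alpha p -> path (G0 B M X) alpha p.
Proof.
move=> sXY; apply: sub_path => mu nu /and4P[nemn Ymu Ynu edge].
by apply/and4P; split=> //; [move: Ymu|move: Ynu]; apply/contra/subsetP.
Qed.

(** Moves the first vertex of a path into the deleted set, matching the recursion of
    [path_weight]. *)
Lemma uniq_notin_cons X beta nu p :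
  uniq [:: beta, nu & p] && all [predC X] (nu :: p) =
  (nu \notin beta |: X) && (uniq (nu :: p) && all [predC beta |: X] p).
Proof.
have -> : all [predC beta |: X] p = (beta \notin p) && all [predC X] p.
  elim: p => //= mu p ->; rewrite !inE !negb_or (eq_sym mu).
  by case: (_ == _); case: (beta \in p); case: (mu \in X).
rewrite /= !inE !negb_or (eq_sym nu).
by case: (_ == _); case: (beta \in p); case: (nu \in X); case: (nu \in p);
  case: (uniq p); case: (all _ p).
Qed.

(* Hence the sums over paths may run over all sequences of distinct vertices. *)
Lemma wt_nonpath X beta p : beta \notin X -> uniq (beta :: p) ->
  all [predC X] p -> ~~ path (G0 B M X) beta p -> wt X beta p = 0.
Proof.
elim: p X beta => // nu p IHp X beta Xbeta u_p Xp.
have := uniq_notin_cons X beta nu p; rewrite u_p Xp.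
case/esym/and3P=> Ynu u_p' Yp; rewrite wt_cons [path _ _ _]/= negb_and.
case/orP.
  move: Ynu; rewrite !inE negb_or => /andP[nebn Xnu] noedge.
  rewrite wt_nil /wt.
  rewrite -!mulmxA [r nu *m _]mulmxA [r nu *m _ *m _]mulmxA.
  by rewrite (non_edge _ Xbeta) // 1?eq_sym // ?mul0mx ?mulmx0.
move=> nopath; rewrite IHp ?mul0mx //; apply: contra nopath.
by apply: sub_path_G0; apply: subsetUr.
Qed.

(** The end point is left free, so that the total can be compared with a whole block column of the
    resolvent. Sequences that are not paths add nothing, by [wt_nonpath]. *)
Definition path_total m X beta : 'M[K]_D :=
  \sum_(k < m) \sum_(p : k.-tuple 'I_n | uniq (beta :: p) && all [predC X] p)
    wt X beta p.

(** Sorts the nontrivial sequences by their second vertex [nu]. *)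
Lemma path_totalS m X beta : beta \notin X ->
  path_total m.+1 X beta
  = wt X beta [::] + \sum_(nu | nu \notin beta |: X)
      path_total m (beta |: X) nu *m MK *m wt X beta [::].
Proof.
move=> Xbeta; rewrite /path_total big_ord_recl; congr (_ + _).
  rewrite (big_pred1 [tuple]) // => p; rewrite tuple0 /=.
  by symmetry; apply/eqP; apply: val_inj.
under [RHS]eq_bigr do rewrite 2!mulmx_suml.
rewrite exchange_big /=; apply: eq_bigr => k _.
rewrite (big_tuple_cons _ (fun p => uniq (beta :: p) && all [predC X] p)
          (wt X beta)).
rewrite [RHS]big_mkcond; apply: eq_bigr => nu _.
rewrite (eq_bigl _ _ (fun p : k.-tuple _ => uniq_notin_cons X beta nu p)).
case: (nu \notin _) => /=; last by rewrite big_pred0.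
by rewrite 2!mulmx_suml; apply: eq_bigr => p _; rewrite wt_cons.
Qed.

Lemma sum_ord_predn (V : nmodType) m (f : nat -> V) : (0 < m)%N -> f 0 = 0 ->
  \sum_(k < m) f k = \sum_(k < m.-1) f k.+1.
Proof. by case: m => // m _ f0; rewrite big_ord_recl f0 add0r. Qed.

(** A bare cycle off [alpha] is a path avoiding [alpha], joined to it at both ends; sequences that
    miss an edge have weight zero. *)
Lemma cycle_weight_wt X alpha nu c : alpha \notin X ->
  (if ucycleb (G0 B M X) [:: alpha, nu & c]
   then cycle_weight M FM X alpha (nu :: c) else 0)
  = if (nu \notin alpha |: X) && (uniq (nu :: c) && all [predC alpha |: X] c)
    then r alpha *m MK *m wt (alpha |: X) nu c *m MK *m (r alpha)^T else 0.
Proof.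
move=> Xalpha; rewrite -uniq_notin_cons /ucycleb [cycle _ _]/=.
have [/andP[u_c Xc]|uXc] := boolP (uniq _ && _); last first.
  case: ifP => // /andP[e_c u_c]; case/negP: uXc; rewrite u_c /=.
  have := @path_notin X alpha (rcons (nu :: c) alpha) e_c.
  by rewrite all_rcons => /andP[].
rewrite u_c andbT; case: ifPn => [_|].
  by rewrite /= !map_block /wt !mulmxA.
have := uniq_notin_cons X alpha nu c.
rewrite u_c Xc => /esym/and3P[Ynu u_c' Yc].
have [nean Xnu] : alpha != nu /\ nu \notin X.
  by move: Ynu; rewrite !inE negb_or eq_sym => /andP[].
(* The missing edge is the one leaving [alpha], an inner one, or the one returning to [alpha]. *)
rewrite rcons_path negb_and => /orP[noedge|/nandP[nopath|noedge]].
- by rewrite -[_ *m MK *m _]mulmxA /wt -!mulmxA [r nu *m _]mulmxA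
    (non_edge nean Xalpha Xnu noedge) !mulmx0.
- rewrite (wt_nonpath Ynu u_c' Yc) ?mulmx0 ?mul0mx //.
  by apply: contra nopath; apply: sub_path_G0; apply: subsetUr.
- have Yl : last nu c \notin alpha |: X.
    have: last nu c \in nu :: c by apply: mem_last.
    by rewrite inE => /predU1P[-> //|/(allP Yc)].
  move: (Yl); rewrite !inE negb_or => /andP[nela Xl].
  by rewrite /wt !mulmxA (non_edge nela Xl Xalpha noedge) !mul0mx.
Qed.

Lemma cycle_sumE X alpha : alpha \notin X ->
  cycle_sum M FM X alpha = r alpha *m MK *m
    (\sum_(nu | nu \notin alpha |: X) path_total n.-1 (alpha |: X) nu)
    *m MK *m (r alpha)^T.
Proof.
move=> Xalpha; rewrite /cycle_sum.
(* The empty sequence of internal vertices has weight zero; removing it shifts the length bound to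
   [n.-1]. *)
rewrite [LHS](@sum_ord_predn _ n (fun k => \sum_(c : k.-tuple 'I_n
  | ucycleb (G0 B M X) (alpha :: c)) cycle_weight M FM X alpha c)).
- rewrite exchange_big mulmx_sumr 2!mulmx_suml; apply: eq_bigr => k _.
  rewrite (big_tuple_cons _ (fun c => ucycleb (G0 B M X) (alpha :: c))
            (cycle_weight M FM X alpha)).
  rewrite mulmx_sumr 2!mulmx_suml [RHS]big_mkcond; apply: eq_bigr => nu _.
  rewrite big_mkcond.
  rewrite (eq_bigr _ (fun (c : k.-tuple _) _ => cycle_weight_wt nu c Xalpha)).
  rewrite -big_mkcond /=; case: ifP => [Ynu|_]; last by rewrite big_pred0.
  by rewrite mulmx_sumr 2!mulmx_suml.
- by apply: leq_ltn_trans (ltn_ord alpha).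
- by rewrite big1 // => c _; rewrite tuple0.
Qed.

Lemma cardC_setU1 X alpha : alpha \notin X -> #|~: X| = #|~: (alpha |: X)|.+1.
Proof.
move=> Xalpha; rewrite (cardsD1 alpha (~: X)) inE Xalpha add1n; congr _.+1.
by apply: eq_card => mu; rewrite !inE negb_or.
Qed.

(** Both claims go through one induction on the number of remaining vertices: [F] at [X] needs the
    path totals at [alpha |: X], and the path total at [X] needs [F] at [X]. The bound on [m]
    suffices because a path visits each remaining vertex at most once. *)
Lemma F_resolvent X alpha : alpha \notin X ->
  FM X alpha = r alpha *m T X *m (r alpha)^T /\
  forall m, (#|~: X| <= m)%N ->
    path_total m X alpha = T X *m (r alpha)^T *m r alpha.
Proof.
have [k] := ubnP #|~: X|; elim: k => // k IHk in X alpha *.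
move=> leXk Xalpha; have cX := cardC_setU1 Xalpha.
(* The block columns of [T (alpha |: X)] add up to it, since it absorbs its projector on the
   right. *)
have sumT m : (#|~: (alpha |: X)| <= m)%N ->
    \sum_(nu | nu \notin alpha |: X) path_total m (alpha |: X) nu
    = T (alpha |: X).
  move=> lem; have [_ TE _ _] := resolventP (alpha |: X).
  rewrite -[RHS]TE mulmx_sumr; apply: eq_bigr => nu Ynu; rewrite mulmxA.
  have [||_ ->] // := IHk (alpha |: X) nu.
  by rewrite -ltnS -cX.
have [Tr] := resolvent_schur Xalpha.
set G := r alpha *m T X *m _ in Tr * => eqG.
(* With the cycle sum evaluated, [Fstep] inverts the Schur complement, of which [G] is a right
   inverse. The bound [n.-1] is large enough because [alpha] itself is deleted. *)
have FG : FM X alpha = G.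
  rewrite F_eq // /Fstep cycle_sumE // map_block sumT.
    have [u _] := mulmx1_unit eqG.
    by rewrite -[RHS](mulKmx u) eqG mulmx1.
  have : (#|~: X| <= n)%N by rewrite -[leqRHS]card_ord max_card.
  by rewrite cX => ltYn; rewrite -ltnS (ltn_predK ltYn).
split=> // -[|m]; first by rewrite cX.
rewrite cX ltnS => lem; rewrite path_totalS //.
by rewrite -2!mulmx_suml sumT // wt_nil FG Tr mulmxDl !mulmxA.
Qed.

(** Multiplying the path total by [r omega] on the left keeps only the paths that end at [omega]. *)
Lemma path_sumE omega alpha :
  path_sum B M omega alpha
  = r omega *m invmx (w%:M - MK) *m (r alpha)^T.
Proof.
have Xalpha : alpha \notin set0 by rewrite inE.
have [_ /(_ n)] := F_resolvent Xalpha.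
rewrite resolvent_set0 => ptE.
transitivity (r omega *m path_total n set0 alpha *m (r alpha)^T); last first.
  rewrite ptE; last by rewrite -[leqRHS]card_ord max_card.
  by rewrite -!mulmxA restrK mulmx1.
rewrite /path_total mulmx_sumr mulmx_suml; apply: eq_bigr => k _.
rewrite mulmx_sumr mulmx_suml big_mkcond [RHS]big_mkcond; apply: eq_bigr => p _.
have X0 (s : seq 'I_n) : all [predC set0] s by apply/allP => x _; rewrite !inE.
rewrite X0 andbT /is_path.
have [u_p|] /= := boolP (uniq _); last by rewrite !andbF.
rewrite /wt !mulmxA; have [lo|nelo] := eqVneq (last alpha p) omega; last first.
  by rewrite !andbF restr_orth ?mul0mx // eq_sym.
rewrite !andbT; case: ifPn => [_|nopath].
  (* Once the end points are identified, [conform_mx] is the identity. *)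
  case: omega / lo; rewrite conform_mx_id restrK mul1mx.
  by rewrite -mulmxA restrK mulmx1.
transitivity (r omega *m wt set0 alpha p *m (r alpha)^T).
  by rewrite (wt_nonpath Xalpha u_p (X0 _) nopath) mulmx0 mul0mx.
by rewrite /wt !mulmxA.
Qed.

End PathSums.

(** * Expansion at infinity *)

Section PolyAction.
Variable C : fieldType.
Implicit Types (p q : {poly C}) (c : int -> C) (m : int).

(* The coefficient of [z^m] in [p * \sum_k (c k) z^k]. *)
Definition shift_action p c m : C := \sum_(i < size p) p`_i * c (m - i%:Z).

Lemma shift_action_widen c m (N : nat) p : (size p <= N)%N ->
  shift_action p c m = \sum_(i < N) p`_i * c (m - i%:Z).
Proof.
move=> lepN; rewrite /shift_action.
rewrite (big_ord_widen N (fun i => p`_i * c (m - i%:Z))) //.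
rewrite big_mkcond; apply: eq_bigr => i _; case: ltnP => // le_pi.
by rewrite nth_default ?mul0r.
Qed.

Lemma eq_shift_action p c1 c2 m : c1 =1 c2 ->
  shift_action p c1 m = shift_action p c2 m.
Proof. by move=> eqc; apply: eq_bigr => i _; rewrite eqc. Qed.

Lemma shift_actionD p q c m :
  shift_action (p + q) c m = shift_action p c m + shift_action q c m.
Proof.
rewrite (shift_action_widen c m (size_polyD p q)).
rewrite (shift_action_widen c m (leq_maxl (size p) (size q))).
rewrite (shift_action_widen c m (leq_maxr (size p) (size q))).
by rewrite -big_split; apply: eq_bigr => i _; rewrite coefD mulrDl.
Qed.

Lemma shift_actionC (a : C) c m : shift_action a%:P c m = a * c m.
Proof.
rewrite (shift_action_widen c m (size_polyC_leq1 a)) big_ord1.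
by rewrite coefC eqxx subr0.
Qed.

Lemma shift_actionX p c m :
  shift_action (p * 'X) c m = shift_action p c (m - 1).
Proof.
have le_pX : (size (p * 'X)%R <= (size p).+1)%N.
  by rewrite (leq_trans (size_polyMleq _ _)) // size_polyX addn2.
rewrite (shift_action_widen c m le_pX) big_ord_recl coefMX mul0r add0r.
apply: eq_bigr => i _; rewrite coefMX /=; congr (_ * c _).
by rewrite -addrA -opprD -intS.
Qed.


Lemma shift_actionZ (a : C) p c m :
  shift_action (a *: p) c m = a * shift_action p c m.
Proof.
rewrite (shift_action_widen c m (size_scale_leq a p)) mulr_sumr.
by apply: eq_bigr => i _; rewrite coefZ mulrA.
Qed.

Lemma shift_action0 c m : shift_action 0 c m = 0.
Proof. by rewrite /shift_action size_poly0 big_ord0. Qed.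

Lemma shift_actionM p q c m :
  shift_action (p * q) c m = shift_action p (shift_action q c) m.
Proof.
elim/poly_ind: p m => [|p a IHp] m; first by rewrite mul0r !shift_action0.
rewrite mulrDl mulrAC !shift_actionD !shift_actionX IHp shift_actionC.
by rewrite mul_polyC shift_actionZ.
Qed.

Lemma shift_action_suml (I : finType) (p : I -> {poly C}) c m :
  shift_action (\sum_i p i) c m = \sum_i shift_action (p i) c m.
Proof.
apply: (big_morph (fun p => shift_action p c m) _ (shift_action0 c m)).
by move=> p1 p2; apply: shift_actionD.
Qed.

Lemma shift_action_sumr (I : finType) p (c : I -> int -> C) m :
  shift_action p (fun k => \sum_i c i k) m = \sum_i shift_action p (c i) m.
Proof. by rewrite exchange_big; apply: eq_bigr => k _; rewrite mulr_sumr. Qed.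

(** The indicator of [0] is the constant series 1, which [p] sends to its own coefficients. *)
Lemma shift_action_delta p m :
  shift_action p (fun k => (k == 0)%:R) m = if m is Posz j then p`_j else 0.
Proof.
case: m => j.
  have [ltjp|lepj] := ltnP j (size p).
    rewrite /shift_action (bigD1 (Ordinal ltjp)) //= subrr eqxx mulr1.
    rewrite big1 ?addr0 // => i neij; rewrite subr_eq0 eqz_nat.
    by move: neij; rewrite -val_eqE /= eq_sym => /negPf ->; rewrite mulr0.
  rewrite nth_default // /shift_action big1 // => i _.
  rewrite subr_eq0 eqz_nat gtn_eqF ?mulr0 //.
  exact: leq_trans (ltn_ord i) lepj.
rewrite /shift_action big1 // => i _; rewrite subr_eq0.
by rewrite (_ : (Negz j == i :> int) = false) ?mulr0.
Qed.

End PolyAction.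

Section Expansion.
Variables (R : realType) (D : nat).
Local Notation C := R[i].
Local Notation K := {fraction {poly C}}.

(* The hypothesis on [c] says that [(1 - z M) * \sum_k (c k) z^k = z]. *)
Lemma expansion_resolvent (M : 'M[C]_D) (c : int -> 'M[C]_D) (N : int) i j :
    (forall k, N < k -> c k = 0) ->
    (forall k, c k - M *m c (k - 1) = (k == 1)%:R%:M) ->
  expansion_at_oo (invmx ((zvar C)^-1%:M - map_mx (@ratC C) M) i j)
    (fun k => c k i j).
Proof.
move=> c0 cE; split; first by exists N => k /c0 ->; rewrite mxE.
set P := 1%:M - 'X *: map_mx polyC M.
(* Cramer's rule: the inverse of [1/z - M] is [z] times the adjugate of [1 - z M] over its
   determinant. *)
exists (\adj P i j * 'X), (\det P); split; first exact: det_1subXM_neq0.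
- have detP : tofrac (\det P) != 0 by rewrite tofrac_eq0 det_1subXM_neq0.
  set A := _ - _.
  pose B := zvar C / tofrac (\det P) *: map_mx (@tofrac {poly C}) (\adj P).
  have AE : A *m B = 1%:M.
    rewrite /A /B resolvent_poly -scalemxAl -scalemxAr scalerA -map_mxM
      mul_mx_adj.
    rewrite map_scalar_mx scale_scalar_mx; congr _%:M.
    by rewrite mulrA mulVf ?zvar_neq0 // mul1r mulVf.
  have [Au _] := mulmx1_unit AE.
  have -> : invmx A = B by rewrite -[RHS](mulKmx Au) AE mulmx1.
  by rewrite mxE [map_mx _ _ _ _]mxE rmorphM /= mulrC mulrA.
move=> m; rewrite -[LHS]/(shift_action (\det P) (fun k => c k i j) m).
rewrite -shift_action_delta shift_actionX.
(* As [\det P] is [\adj P] times [P], and [P] sends the series to [z] times the identity, [\det P]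
   sends it to [z] times [\adj P]. *)
have detE k : ((\det P)%:M : 'M_D) i k = \sum_l \adj P i l * P l k.
  by rewrite -mul_adj_mx mxE.
have PE l k : \sum_h shift_action (P l h) (fun k => c k h j) k
              = (l == j)%:R * (k == 1)%:R.
  transitivity ((c k - M *m c (k - 1)) l j); last first.
    by rewrite cE !mxE; case: (l == j); rewrite ?mul1r ?mul0r.
  rewrite 3!mxE -sumrN.
  transitivity (\sum_h (shift_action (1%:M l h) (fun k => c k h j) k
                        - M l h * c (k - 1) h j)).
    apply: eq_bigr => h _.
    rewrite !mxE mulrC shift_actionD -mulNr shift_actionX.
    by rewrite -polyCN shift_actionC mulNr.
  rewrite big_split /=; congr (_ + _); rewrite (bigD1 l) //= mxE eqxx.
  rewrite shift_actionC mul1r big1 ?addr0 // => h nehl.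
  by rewrite mxE eq_sym (negPf nehl) shift_action0.
transitivity (\sum_h shift_action (((\det P)%:M : 'M_D) i h)
                (fun k => c k h j) m).
  rewrite (bigD1 i) //= mxE eqxx big1 ?addr0 // => h neih.
  by rewrite mxE eq_sym (negPf neih) shift_action0.
under eq_bigr => h _ do rewrite detE shift_action_suml.
rewrite exchange_big /=.
transitivity (\sum_l shift_action (\adj P i l)
                (fun k => (l == j)%:R * (k == 1)%:R) m).
  apply: eq_bigr => l _.
  under eq_bigr => h _ do rewrite shift_actionM.
  rewrite -shift_action_sumr; exact: eq_shift_action.
rewrite (bigD1 j) //= big1 ?addr0 => [|l nelj].
  rewrite eqxx; apply: eq_bigr => k _; rewrite mul1r.
  by rewrite [m - 1 - _]addrAC subr_eq0.
by rewrite /shift_action big1 // => k _; rewrite (negPf nelj) mul0r mulr0.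
Qed.
End Expansion.

(** * Spectral projectors *)

Lemma char_poly_trmx (S : comNzRingType) (m : nat) (A : 'M[S]_m) :
  char_poly A^T = char_poly A.
Proof.
rewrite /char_poly -[RHS]det_tr; congr (\det _); apply/matrixP => i j.
by rewrite !mxE eq_sym.
Qed.

Lemma trmx_exp (S : comNzRingType) (m : nat) (A : 'M[S]_m) k :
  (A ^+ k)^T = A^T ^+ k.
Proof.
by elim: k => [|k IHk]; rewrite ?trmx1 // exprS exprSr -IHk -mulmxE trmx_mul.
Qed.

Section Spectral.
Variables (R : realType) (D : nat).
Local Notation C := R[i].
Variable M : 'M[C]_D.+1.
Local Notation s := (spectrum M).
Local Notation g := (geigenspace M^T).

(** Powers of distinct linear factors are coprime, so the sum is the kernel of their product
    evaluated at [M^T]. This kernel is everything, because the product is a multiple of the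
    characteristic polynomial: multiplicities are at most [D.+1]. *)
Lemma sum_geigenspace : (\sum_(i < size s) g s`_i :=: 1%:M)%MS.
Proof.
apply: eqmx_trans (eqmx_sym (kermxpoly_prod _ _)) (kermxpoly_min _).
  move=> i j _ _ neji; rewrite coprimep_expr ?coprimep_expl //.
  by rewrite coprimep_XsubC root_XsubC nth_uniq ?undup_uniq // eq_sym.
apply: dvdp_trans (mxminpoly_dvd_char _) _.
rewrite char_poly_trmx.
rewrite -(big_mkord xpredT (fun i => ('X - (s`_i)%:P) ^+ D.+1)).
rewrite -(big_nth 0 xpredT (fun a => ('X - a%:P) ^+ D.+1)).
have szc := size_char_poly M.
rewrite /spectrum; case: closed_field_poly_normal => rts /= chE.
have /monicP lc := char_poly_monic M.
rewrite lc scale1r in chE; rewrite chE size_prod_XsubC in szc *.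
case: szc => szr.
rewrite -(prodr_undup_exp_count rts xpredT).
elim: (undup rts) => [|a t IHt]; first by rewrite !big_nil.
rewrite !big_cons dvdp_mul //.
by rewrite dvdp_exp2l // -szr count_size.
Qed.

Lemma eq_on_geigenspaces (X Y : 'M[C]_D.+1) :
  (forall i : 'I_(size s), g s`_i *m X = g s`_i *m Y) -> X = Y.
Proof.
move=> eqXY; apply/eqP; rewrite -subr_eq0 -[X - Y]mul1mx.
apply/eqP/sub_kermxP; rewrite -sum_geigenspace; apply/sumsmx_subP => i _.
by apply/sub_kermxP; rewrite mulmxBr eqXY subrr.
Qed.

Local Notation pr a := (proj_mx (g a) (\sum_(b <- s | b != a) g b)%MS).

Lemma geigenspace_proj (i j : 'I_(size s)) :
  g s`_j *m pr s`_i = if j == i then g s`_j else 0.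
Proof.
have -> : (\sum_(b <- s | b != s`_i) g b)%MS
          = (\sum_(k < size s | k != i) g s`_k)%MS.
  rewrite (big_nth 0) big_mkord; apply: eq_bigl => k.
  by rewrite nth_uniq ?undup_uniq.
have dx : (g s`_i :&: \sum_(k < size s | k != i) g s`_k = 0)%MS.
  have inj_s : {in xpredT &, injective (fun k : 'I_(size s) => s`_k)}.
    move=> k l _ _ /eqP; rewrite nth_uniq ?undup_uniq // => /eqP.
    exact: val_inj.
  have /mxdirect_sumsP/(_ i isT) := mxdirect_sum_geigenspace M^T inj_s.
  by rewrite (eq_bigl (fun k => k != i)).
case: eqP => [->|/eqP neji]; first by rewrite proj_mx_id.
by apply: (proj_mx_0 dx); apply: (sumsmx_sup j).
Qed.

Lemma sum_spectral_proj : \sum_(a <- s) spectral_proj M a = 1%:M.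
Proof.
rewrite /spectral_proj -(trmx1 _ D.+1) (big_nth 0) big_mkord -linear_sum /=.
congr (_^T); apply: eq_on_geigenspaces => j; rewrite mulmx1 mulmx_sumr.
rewrite (eq_bigr _ (fun i _ => geigenspace_proj i j)).
by rewrite -big_mkcond (big_pred1 j) // => i; rewrite eq_sym.
Qed.

(** The image of the transposed projector lies in a generalized eigenspace, the kernel of this
    power. *)
Lemma spectral_proj_nilp a : (M - a%:M) ^+ D.+1 *m spectral_proj M a = 0.
Proof.
apply: trmx_inj; rewrite trmx_mul trmxK trmx0.
rewrite trmx_exp linearB /= tr_scalar_mx.
apply/sub_kermxP; rewrite -geigenspaceE.
by rewrite -[pr a]mul1mx proj_mx_sub.
Qed.

End Spectral.

(** * Laurent coefficients of the resolvent *)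

Section ComplexPower.
Variable R : realType.
Local Notation C := R[i].

Lemma cexpD (u v : C) : cexp (u + v) = cexp u * cexp v.
Proof.
case: u v => [a b] [c d]; rewrite /cexp /= expRD cosD sinD.
by apply/eqP; rewrite eq_complex /=; apply/andP; split; apply/eqP; ring.
Qed.

(** For a fixed logarithm, lowering the exponent by 1 divides by [cexp (L a) = a]. *)
Lemma cpow_subn (L : C -> C) (hL : is_log L) (a q : C) j :
  a != 0 -> cpow L a (q - j%:R) = cpow L a q * a ^- j.
Proof.
move=> a0; apply: (canRL (mulfK _)); first by rewrite expf_neq0.
elim: j => [|j IHj]; first by rewrite subr0 mulr1.
rewrite -IHj exprS mulrA; congr (_ * _).
rewrite /cpow -{2}(hL a a0) -cexpD; congr cexp.
by rewrite -natr1; ring.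
Qed.

Lemma gbinom0 (q : C) : gbinom q 0 = 1.
Proof. by rewrite /gbinom big_ord0 divr1. Qed.

Lemma gbinom0S j : gbinom 0 j.+1 = 0 :> C.
Proof. by rewrite /gbinom big_ord_recl subr0 !mul0r. Qed.

Lemma gbinom_pascal (q : C) j :
  gbinom (q + 1) j.+1 = gbinom q j.+1 + gbinom q j.
Proof.
have fact_neq0 k : k`!%:R != 0 :> C by rewrite pnatr_eq0 -lt0n fact_gt0.
have jS : j.+1%:R != 0 :> C by rewrite pnatr_eq0.
rewrite /gbinom big_ord_recl big_ord_recr /= subr0.
rewrite (eq_bigr (fun i : 'I_j => q - i%:R)); last first.
  by move=> i _; rewrite /bump /= natrD opprD addrA addrK.
rewrite factS natrM; set p := \prod_(i < j) _.
have := jS; rewrite -natr1 => jS'; field.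
by rewrite fact_neq0.
Qed.

End ComplexPower.

Section Laurent.
Variables (R : realType) (D : nat).
Local Notation C := R[i].
Variable M : 'M[C]_D.+1.
Local Notation Pi := (spectral_proj M).

(* The restriction of [M^-n] to the generalized eigenspace of [a != 0]. *)
Definition laurent_part (a : C) (n : nat) : 'M[C]_D.+1 :=
  \sum_(j < D.+1) (gbinom (- n%:R) j * a ^- (n + j))
     *: ((M - a%:M) ^+ j *m Pi a).

Lemma laurent_part0 a : laurent_part a 0 = Pi a.
Proof.
rewrite /laurent_part big_ord_recl big1 => [|j _]; last first.
  by rewrite oppr0 gbinom0S mul0r scale0r.
by rewrite gbinom0 expr0 invr1 mulr1 scale1r mul1mx addr0.
Qed.

(** Split [M] as [a + (M - a)] and compare coefficients of the powers of [M - a], using Pascal's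
    rule at the exponent [- n.+1]. *)
Lemma laurent_partS a n : a != 0 -> M *m laurent_part a n.+1 = laurent_part a n.
Proof.
move=> a0; have {1}-> : M = a%:M + (M - a%:M) by rewrite addrC subrK.
rewrite mulmxDl mul_scalar_mx /laurent_part scaler_sumr mulmx_sumr.
(* The top term contains [(M - a) ^+ D.+1] and vanishes on the generalized eigenspace. *)
rewrite big_ord_recl [X in _ + X]big_ord_recr /= -scalemxAr mulmxA mulmxE.
rewrite -exprS -mulmxE spectral_proj_nilp scaler0 addr0 -addrA -big_split /=.
rewrite [RHS]big_ord_recl; congr (_ + _).
  rewrite scalerA !gbinom0 !mul1r; congr (_ *: _).
  by rewrite addSn exprS invfM mulrA mulfV ?mul1r.
apply: eq_bigr => j _; rewrite scalerA -scalemxAr mulmxA mulmxE -exprS -mulmxE.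
rewrite /bump /= add1n -scalerDl; congr (_ *: _).
have {1}-> : - n%:R = - n.+1%:R + 1 :> C by rewrite -natr1; ring.
rewrite gbinom_pascal mulrDl mulrCA; congr (_ * _ + _ * a ^- _).
  by rewrite addSn exprS invfM mulrA mulfV ?mul1r.
by rewrite addSnnS.
Qed.

Local Notation s := (spectrum M).

(* Coefficient of [z^k] in the expansion at infinity of [(1/z - M)^-1]. *)
Definition laurent_coef (k : int) : 'M[C]_D.+1 :=
  match k with
  | Posz 0 => - \sum_(a <- s | a != 0) laurent_part a 1
  | Posz k.+1 => M ^+ k *m (1%:M - \sum_(a <- s | a != 0) Pi a)
  | Negz n => - \sum_(a <- s | a != 0) laurent_part a n.+2
  end.

Lemma laurent_coef_neg n :
  laurent_coef (- n%:Z) = - \sum_(a <- s | a != 0) laurent_part a n.+1.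
Proof. by case: n. Qed.

Lemma mul_laurent_coef n :
  M *m laurent_coef (- n%:Z) = - \sum_(a <- s | a != 0) laurent_part a n.
Proof.
rewrite laurent_coef_neg mulmxN mulmx_sumr; congr (- _).
by apply: eq_bigr => a a0; rewrite laurent_partS.
Qed.

Lemma laurent_coef_rec k :
  laurent_coef k - M *m laurent_coef (k - 1) = (k == 1)%:R%:M.
Proof.
case: k => [[|[|k]]|n].
- by rewrite -[0 - 1]/(- 1%:Z) mul_laurent_coef subrr raddf0.
(* At [k = 1] the parts for zero and for nonzero eigenvalues recombine to the identity. *)
- rewrite subrr -[0]/(- 0%:Z) mul_laurent_coef /= mul1mx opprK.
  by rewrite [X in _ + X](eq_bigr _ (fun a _ => laurent_part0 a)) subrK.
- rewrite -[k.+2%:Z - 1]/(k.+1%:Z).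
  by rewrite /= mulmxA mulmxE -exprS subrr raddf0.
- rewrite (_ : Negz n - 1 = - n.+2%:Z); last first.
    by rewrite NegzE -opprD addrC -intS.
  by rewrite mul_laurent_coef NegzE laurent_coef_neg subrr raddf0.
Qed.

(** Only the generalized eigenspace of 0 is left, and there the power of [M] vanishes. *)
Lemma laurent_coef_gt k : D.+1%:Z < k -> laurent_coef k = 0.
Proof.
case: k => // -[//|k]; rewrite ltz_nat ltnS => leDk /=.
have -> : 1%:M - \sum_(a <- s | a != 0) Pi a = \sum_(a <- s | a == 0) Pi a.
  rewrite -(sum_spectral_proj M) (bigID (fun a => a == 0)) /= addrK //.
rewrite mulmx_sumr big1 // => a /eqP->.
have := spectral_proj_nilp M 0; rewrite raddf0 subr0 => nilp.
by rewrite -(subnK leDk) exprD -mulmxE -mulmxA nilp mulmx0.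
Qed.

Local Notation A := ((zvar C)^-1%:M - map_mx (@ratC C) M).

Lemma inverse_Z_resolventS (L : C -> C) (hL : is_log L) q i j :
  inverse_Z_at L s (invmx A i j) (- q - 1) (- mxpow L M q i j).
Proof.
(* The binomial coefficient of [- n - 1] over [k] is a polynomial in [n]; at [n = - q - 1] it
   becomes that of [q] over [k]. *)
pose P (a : C) : {poly C} := - \sum_(k < D.+1)
  (((M - a%:M) ^+ k *m Pi a) i j * a ^- k / k`!%:R)
     *: \prod_(l < k) (- 'X - 1 - l%:R%:P).
have PE a t : (P a).[t] = - \sum_(k < D.+1)
    gbinom (- t - 1) k * a ^- k * ((M - a%:M) ^+ k *m Pi a) i j.
  rewrite hornerN horner_sum; congr (- _); apply: eq_bigr => k _.
  rewrite hornerZ horner_prod /gbinom.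
  rewrite (eq_bigr (fun l : 'I_k => - t - 1 - l%:R)) => [|l _].
    ring.
  by rewrite !hornerE.
exists (fun k => laurent_coef k i j), P; rewrite undup_id ?undup_uniq //; split.
- exact: expansion_resolvent laurent_coef_gt laurent_coef_rec.
- move=> n; rewrite laurent_coef_neg mxE summxE -sumrN.
  apply: eq_bigr => a a0; rewrite PE mulNr; congr (- _).
  rewrite summxE mulr_suml; apply: eq_bigr => k _; rewrite mxE.
  rewrite -opprD natr1 addnC exprD invfM; ring.
- rewrite summxE -sumrN; apply: eq_bigr => a a0; rewrite PE mulNr; congr (- _).
  rewrite summxE mulr_suml; apply: eq_bigr => k _; rewrite mxE cpow_subn //.
  have -> : - (- q - 1) - 1 = q by ring.
  ring.
Qed.
End Laurent.

Lemma inverse_Z_resolvent (R : realType) (D : nat) (M : 'M[R[i]]_D)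
    (L : R[i] -> R[i]) (hL : is_log L) q i j :
  inverse_Z_at L (spectrum M)
    (invmx ((zvar _)^-1%:M - map_mx (@ratC _) M) i j)
    (- q - 1) (- mxpow L M q i j).
Proof.
by case: D M i j => [M []//|D M i j]; apply: inverse_Z_resolventS.
Qed.

Theorem theorem3p1 (R : realType) (D n : nat) (B : 'I_n -> {set 'I_D})
    (hB : is_partition B) (M : 'M[R[i]]_D)
    (hM : ~ exists k : nat, M ^+ k = 0)
    (L : R[i] -> R[i]) (hL : is_log L) (q : R[i]) (omega alpha : 'I_n) :
  exists V : 'M[R[i]]_(bdim B omega, bdim B alpha),
    (forall i j, inverse_Z_at L (spectrum M) (path_sum B M omega alpha i j)
                   (- q - 1) (V i j)) /\
    block B (mxpow L M q) omega alpha = - V.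
Proof.
(* By [path_sumE] each entry of the path sum is an entry of the resolvent, so the inverse transform
   is taken entrywise. *)
exists (- block B (mxpow L M q) omega alpha); split; last by rewrite opprK.
move=> i j; rewrite mxE path_sumE // blockE.
by rewrite -/(block B _ omega alpha) blockE; apply: inverse_Z_resolvent.
Qed.
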